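(* Let $K\subset\mathbb{R}^n$ be a closed set whose complement $K^c$ is a bounded open set, let $\alpha\ge0$, $\lambda>0$, $\mu\in(0,1]$ and $\alpha'$ with $0<\alpha'\le\alpha$ such that $r_\mu^{\alpha'}(K)>\alpha+\lambda$. Then $\mathrm{ax}_\lambda^\alpha(K)$ has the same homotopy type as $(K^{\oplus\alpha'})^c$.
   Context: For a closed set $K\subset\mathbb{R}^n$ with bounded open complement: $R_K(x)=d(x,K)$; $\Theta_K(x)=\{y\in K:\|x-y\|=R_K(x)\}$; for bounded $S$, $\mathrm{center}(S)$ and $\mathrm{radius}(S)$ are the center and radius of the smallest ball enclosing $S$; $\mathcal F_K(x)=\mathrm{radius}(\Theta_K(x))$; for $x\notin K$, $\nabla_K(x)=(x-\mathrm{center}(\Theta_K(x)))/R_K(x)$. $R_{\max}(K)=\max_{x\in K^c}R_K(x)$. Critical function: $\chi_K(t)=\inf\{\|\nabla_K(x)\|:R_K(x)=t\}$ for $t\in(0,R_{\max}(K)]$ (infimum of empty set $=1$). $K^{\oplus\alpha}=\{x:d(x,K)\le\alpha\}$. For $\mu\in(0,1]$, $\alpha\ge0$: $r_\mu^\alpha(K)=\inf\{t>\alpha:\chi_K(t)<\mu\}$. $\mathrm{ax}_\lambda^\alpha(K)=\{x:\mathcal F_{K^{\oplus\alpha}}(x)\ge\lambda\}$. *)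

(* Defs.v *)
(* Ambient space R^n is 'rV[R]_n over
   R : realType, with its library topology; Euclidean quantities (distance,
   enclosing balls) use the explicitly defined Euclidean norm [enorm]. *)
From HB Require Import structures.
From mathcomp Require Import all_boot all_order all_algebra.
From mathcomp Require Import all_classical all_reals.
From mathcomp Require Import ereal topology normedtype.
Set Implicit Arguments. Unset Strict Implicit. Unset Printing Implicit Defensive.
Import Order.TTheory GRing.Theory Num.Theory.
Import numFieldNormedType.Exports.
Local Open Scope classical_set_scope.
Local Open Scope ring_scope.

Section Defs.
Variables (R : realType) (n : nat).
Notation V := 'rV[R]_n.

Definition enorm (x : V) : R := Num.sqrt (\sum_i (x ord0 i) ^+ 2).

Definition edist (K : set V) (x : V) : R := inf [set enorm (x - y) | y in K].

Definition Theta (K : set V) (x : V) : set V :=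
  [set y | K y /\ enorm (x - y) = edist K x].

Definition encl_radius (S : set V) : R :=
  inf [set r | 0 <= r /\ exists c : V, forall y, S y -> enorm (y - c) <= r].

(* center of the smallest enclosing ball (unique for bounded nonempty S) *)
Definition encl_center (S : set V) : V :=
  get [set c : V | forall y, S y -> enorm (y - c) <= encl_radius S].

Definition Fk (K : set V) (x : V) : R := encl_radius (Theta K x).

Definition gradK (K : set V) (x : V) : V :=
  (edist K x)^-1 *: (x - encl_center (Theta K x)).

(* critical function; inf of the empty set is 1 *)
Definition chi (K : set V) (t : R) : R :=
  if pselect (exists x, edist K x = t)
  then inf [set enorm (gradK K x) | x in [set x | edist K x = t]]
  else 1.

Definition thicken (K : set V) (a : R) : set V := [set x | edist K x <= a].

Definition r_mu (mu a : R) (K : set V) : \bar R :=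
  ereal_inf [set t%:E | t in [set t : R | a < t /\ chi K t < mu]].

Definition ax (lam a : R) (K : set V) : set V :=
  [set x | lam <= Fk (thicken K a) x].

Definition homotopy_equiv (A B : set V) : Prop :=
  exists (f g : V -> V),
    [/\ {within A, continuous f} /\ (forall x, A x -> B (f x)),
        {within B, continuous g} /\ (forall y, B y -> A (g y)),
        (exists H : V * R -> V,
          [/\ {within A `*` `[0, 1]%classic, continuous H},
              (forall x t, A x -> `[0, 1]%classic t -> A (H (x, t))),
              (forall x, A x -> H (x, 0) = g (f x)) &
              (forall x, A x -> H (x, 1) = x)]) &
        (exists H : V * R -> V,
          [/\ {within B `*` `[0, 1]%classic, continuous H},
              (forall y t, B y -> `[0, 1]%classic t -> B (H (y, t))),
              (forall y, B y -> H (y, 0) = f (g y)) &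
              (forall y, B y -> H (y, 1) = y)])].
End Defs.

(* Main.v *)
Require Import Defs.
From HB Require Import structures.
From mathcomp Require Import all_boot all_order all_algebra.
From mathcomp Require Import all_classical all_reals.
From mathcomp Require Import ereal topology normedtype.
From mathcomp Require Import derive ring lra.
(* Reimported so that [edist] is the one of Defs, not the extended distance of
   MathComp-Analysis. *)
Import Defs.
Import Order.TTheory GRing.Theory Num.Theory.
Import numFieldNormedType.Exports.
Local Open Scope classical_set_scope.
Local Open Scope ring_scope.

(** Write rho for the distance to K and F(x) for the radius of Theta(x). The
function g = (|x|^2 - rho^2) / 2 is convex, so rho^2 / 2 has an ascent flow, and
x - center(Theta(x)) is the shortest vector w with x - w in the subdifferential
of g at x; moreover F^2 = rho^2 - |x - center(Theta(x))|^2. Instead of the flow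
we use its implicit Euler step J_h : x |-> y, where y = x + h w and y - w is a
subgradient of g at y. For 0 <= h <= 1/2 it exists (y maximises
rho^2(z) - |z - x|^2 / h), is Lipschitz jointly in (h, x), and increases both
rho and F. As F for the alpha-offset of K is (1 - alpha / rho) F where
rho > alpha and 0 elsewhere, J_h preserves the medial axis and the complement of
the alpha'-offset. Off the medial axis but in that complement |w| is bounded
below: by the hypothesis on chi when rho is at most slightly above
alpha + lambda, and by F^2 >= rho^2 - |w|^2 when rho is larger. Each such step
increases rho^2 by h (2 - h) |w|^2, while rho is bounded, so some iterate of
J_(1/2) sends the complement of the offset into the medial axis. The same
iterate of J_((1-t)/2) joins it to the identity. *)

(** * Euclidean geometry *)

Definition dot {R : realType} {n : nat} (x y : 'rV[R]_n) : R :=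
  \sum_i x ord0 i * y ord0 i.

(** Scalars and signs are pushed into the sums and the sums merged, so that an identity between
    [dot] terms becomes a [ring] identity between summands. *)
Ltac dot_ring :=
  rewrite /dot 10?mulr_sumr -10?sumrN -20?big_split /=;
  apply: eq_bigr => i _; rewrite ?mxE; ring.

Section Euclid.
Set Implicit Arguments. Unset Strict Implicit.
Context {R : realType} {n : nat}.
Implicit Types x y z c w : 'rV[R]_n.

Lemma dot_ge0 x : 0 <= dot x x.
Proof. by apply: sumr_ge0 => i _; rewrite -expr2 sqr_ge0. Qed.

Lemma sqr_enorm x : enorm x ^+ 2 = dot x x.
Proof.
rewrite /enorm sqr_sqrtr; first by apply: eq_bigr => i _; rewrite expr2.
by apply: sumr_ge0 => i _; rewrite sqr_ge0.
Qed.

Lemma enorm_ge0 x : 0 <= enorm x. Proof. exact: sqrtr_ge0. Qed.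

Lemma enorm_leP x (r : R) : 0 <= r -> (enorm x <= r) = (dot x x <= r ^+ 2).
Proof. by move=> r0; rewrite -sqr_enorm ler_pXn2r ?nnegrE ?enorm_ge0. Qed.

Lemma enormZ (a : R) x : enorm (a *: x) = `|a| * enorm x.
Proof.
apply/eqP; rewrite -(@eqrXn2 _ 2%N) ?enorm_ge0 ?mulr_ge0 ?enorm_ge0 //.
by rewrite exprMn !sqr_enorm real_normK ?num_real //; apply/eqP; dot_ring.
Qed.

Lemma enormZ_ge0 (a : R) x : 0 <= a -> enorm (a *: x) = a * enorm x.
Proof. by move=> a0; rewrite enormZ ger0_norm. Qed.

Lemma enormB x y : enorm (x - y) = enorm (y - x).
Proof. by rewrite /enorm; congr Num.sqrt; apply: eq_bigr => i _; rewrite !mxE; ring. Qed.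

Lemma enorm0 : enorm (0 : 'rV[R]_n) = 0.
Proof. by rewrite -(scale0r 0) enormZ normr0 mul0r. Qed.

Lemma enorm_eq0 x : enorm x = 0 -> x = 0.
Proof.
move=> x0; have /eqP : dot x x = 0 by rewrite -sqr_enorm x0 expr0n.
rewrite psumr_eq0 => [/allP h|i _]; last by rewrite -expr2 sqr_ge0.
apply/rowP => i; rewrite !mxE; apply/eqP.
by have := h i (mem_index_enum i); rewrite mulf_eq0 orbb ord1.
Qed.

(** Cauchy-Schwarz, by expanding the square of [enorm y *: x - enorm x *: y] and dividing by
    [enorm x * enorm y]. *)
Lemma dot_le_enorm x y : dot x y <= enorm x * enorm y.
Proof.
have [/enorm_eq0 ->|x0] := eqVneq (enorm x) 0.
  by rewrite enorm0 mul0r /dot big1 // => i _; rewrite mxE mul0r.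
have [/enorm_eq0 ->|y0] := eqVneq (enorm y) 0.
  by rewrite enorm0 mulr0 /dot big1 // => i _; rewrite mxE mulr0.
have xy : 0 < enorm x * enorm y.
  by rewrite mulr_gt0 // lt0r ?x0 ?y0 enorm_ge0.
have := dot_ge0 (enorm y *: x - enorm x *: y).
have -> : dot (enorm y *: x - enorm x *: y) (enorm y *: x - enorm x *: y) =
  enorm y ^+ 2 * dot x x + - (2 * (enorm x * enorm y) * dot x y)
  + enorm x ^+ 2 * dot y y by dot_ring.
rewrite -!sqr_enorm => h; rewrite -(ler_pM2l xy); nra.
Qed.

Lemma enormD x y : enorm (x + y) <= enorm x + enorm y.
Proof.
rewrite enorm_leP ?addr_ge0 ?enorm_ge0 //.
have -> : dot (x + y) (x + y) = dot x x + 2 * dot x y + dot y y by dot_ring.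
by have := dot_le_enorm x y; rewrite -!sqr_enorm; nra.
Qed.

Lemma enorm_triangle x y z : enorm (x - z) <= enorm (x - y) + enorm (y - z).
Proof. by rewrite (le_trans _ (enormD _ _)) // addrA subrK. Qed.

(** The topology of row vectors comes from the sup norm; this bound and [enorm_le_norm] pass between
    it and the Euclidean norm. *)
Lemma norm_le_enorm x : `|x| <= enorm x.
Proof.
rewrite [leLHS]/Num.Def.normr /= mx_normrE; apply/bigmax_leP.
split=> [|[i j] _]; first exact: enorm_ge0.
rewrite -sqrtr_sqr /enorm; apply: ler_wsqrtr => /=.
by rewrite ord1 (bigD1 j) //= lerDl; apply: sumr_ge0 => k _; rewrite sqr_ge0.
Qed.

Lemma norm_coord_le x i : `|x ord0 i| <= `|x|.
Proof.
rewrite [leRHS]/Num.Def.normr /= mx_normrE.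
by apply/bigmax_geP; right => /=; exists (ord0, i).
Qed.

Lemma enorm_le_norm x : enorm x <= Num.sqrt n%:R * `|x|.
Proof.
have -> : Num.sqrt n%:R * `|x| = Num.sqrt (n%:R * `|x| ^+ 2).
  by rewrite sqrtrM ?ler0n // sqrtr_sqr normr_id.
apply: ler_wsqrtr.
apply: (@le_trans _ _ (\sum_(i < n) `|x| ^+ 2)); last first.
  by rewrite sumr_const card_ord mulr_natl.
apply: ler_sum => i _; rewrite -real_normK ?num_real // ler_pXn2r ?nnegrE //.
exact: norm_coord_le.
Qed.

Lemma enorm_lipschitz_continuous (f : 'rV[R]_n -> R) (C : R) :
  (forall x y, f x <= f y + C * enorm (x - y)) -> continuous f.
Proof.
move=> lip x; apply/(@cvgrPdist_le R R _ (nbhs x)) => e e0.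
have C0 : 0 <= `|C| * Num.sqrt n%:R by rewrite mulr_ge0 ?sqrtr_ge0.
(* The added 1 keeps the divisor positive when [C] or [n] is zero. *)
have c0 : 0 < `|C| * Num.sqrt n%:R + 1 by lra.
near=> y.
apply: (@le_trans _ _ (`|C| * enorm (x - y))).
  have le_C u v : f u <= f v + `|C| * enorm (u - v).
    by rewrite (le_trans (lip u v)) // lerD2l ler_wpM2r ?enorm_ge0 ?ler_norm.
  by have := le_C x y; have := le_C y x; rewrite (enormB y) ler_norml; lra.
have h : (`|C| * Num.sqrt n%:R + 1) * `|x - y| <= e.
  rewrite -ler_pdivlMl // mulrC; near: y.
  have /cvgrPdist_le : z @[z --> x] --> x by exact: cvg_id.
  by apply; rewrite divr_gt0.
apply: le_trans h; rewrite mulrDl mul1r -mulrA.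
by rewrite (le_trans (ler_wpM2l _ (enorm_le_norm _))) // lerDl.
Unshelve. all: by end_near. Qed.

Lemma continuous_enormB c : continuous (fun y => enorm (y - c)).
Proof.
apply: (@enorm_lipschitz_continuous _ 1) => x y.
by rewrite mul1r [leRHS]addrC enorm_triangle.
Qed.

Lemma continuous_dot w : continuous (dot w).
Proof.
apply: (@enorm_lipschitz_continuous _ (enorm w)) => x y.
have -> : dot w x = dot w y + dot w (x - y) by dot_ring.
by rewrite lerD2l dot_le_enorm.
Qed.

Lemma closed_enorm_ball c (r : R) : closed [set y | enorm (y - c) <= r].
Proof.
apply: (@preimage_closed _ _ (fun y => enorm (y - c)) [set t | t <= r]).
  by move=> x _; exact: continuous_enormB.
exact: closed_le.
Qed.

Lemma enorm_bounded_compact (A : set 'rV[R]_n) c (r : R) : closed A ->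
  (forall y, A y -> enorm (y - c) <= r) -> compact A.
Proof.
move=> clA bA; apply: bounded_closed_compact clA.
exists (r + enorm c); split; first exact: num_real.
move=> M rM x /bA xr; apply: le_trans (ltW rM).
apply: (le_trans (norm_le_enorm x)).
by rewrite -[x in enorm x](subrK c) (le_trans (enormD _ _)) // lerD2r.
Qed.

End Euclid.

(** * Distance and nearest points *)

Section Distance.
Set Implicit Arguments. Unset Strict Implicit.
Context {R : realType} {n : nat}.
Implicit Types (x y z c w : 'rV[R]_n) (K S : set 'rV[R]_n).

Lemma edist_le K x y : K y -> edist K x <= enorm (x - y).
Proof.
move=> Ky; apply: ge_inf; last by exists y.
by exists 0 => _ [z _ <-]; exact: enorm_ge0.
Qed.

Lemma le_edist K x (r : R) : K !=set0 ->
  (forall y, K y -> r <= enorm (x - y)) -> r <= edist K x.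
Proof.
move=> [y Ky] h; apply: lb_le_inf; first by exists (enorm (x - y)), y.
by move=> _ [z Kz <-]; exact: h.
Qed.

Lemma edist_ge0 K x : K !=set0 -> 0 <= edist K x.
Proof. by move=> K0; apply: le_edist => // y _; exact: enorm_ge0. Qed.

(** The distance is minimised over the compact part [A] of [K] in a ball around [x] through a point
    of [K]; the rest of [K] is farther away. *)
Lemma Theta_neq0 K x : closed K -> K !=set0 -> Theta K x !=set0.
Proof.
move=> clK [y0 Ky0]; pose A := K `&` [set y | enorm (y - x) <= enorm (y0 - x)].
have cA : compact A.
  apply: (@enorm_bounded_compact _ _ _ x (enorm (y0 - x))) => [|y []//].
  by apply: closedI => //; exact: closed_enorm_ball.
have [||c /set_mem[Kc cx] cmin] := EVT_min_rV (f := fun y => enorm (y - x)) _ cA.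
- by exists y0; split => //=.
- by apply: continuous_subspaceT => y; exact: continuous_enormB.
exists c; split => //; apply/le_anti; rewrite edist_le // andbT.
apply: le_edist => [|y Ky]; first by exists y0.
rewrite enormB (enormB x y).
have [yx|/ltW yx] := leP (enorm (y - x)) (enorm (y0 - x)).
  by apply: cmin; rewrite inE.
exact: le_trans cx yx.
Qed.

Lemma edist_lipschitz K x z : K !=set0 ->
  edist K x <= edist K z + enorm (x - z).
Proof.
move=> K0; rewrite -lerBlDr; apply: le_edist => // y Ky.
rewrite lerBlDr addrC; apply: le_trans (enorm_triangle x z y).
exact: edist_le.
Qed.

Lemma continuous_edist K : K !=set0 -> continuous (edist K).
Proof.
move=> K0; apply: (@enorm_lipschitz_continuous _ _ _ 1) => x y.
by rewrite mul1r; exact: edist_lipschitz.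
Qed.

Lemma edist_mem K x : K x -> edist K x = 0.
Proof.
move=> Kx; apply/le_anti; rewrite edist_ge0; last by exists x.
by rewrite (le_trans (edist_le x Kx)) // subrr enorm0.
Qed.

Lemma edist_sqr_le K x y : K y -> edist K x ^+ 2 <= dot (x - y) (x - y).
Proof.
move=> Ky; rewrite -sqr_enorm ler_pXn2r ?nnegrE ?enorm_ge0 ?edist_le //.
by apply: edist_ge0; exists y.
Qed.

Lemma closed_Theta K x : closed K -> closed (Theta K x).
Proof.
move=> clK; have -> : Theta K x = K `&` [set y | enorm (y - x) <= edist K x].
  apply/seteqP; split=> y [Ky yx]; split => //=; first by rewrite enormB yx.
  by apply/le_anti; rewrite edist_le // andbT enormB.
by apply: closedI => //; exact: closed_enorm_ball.
Qed.

Lemma Theta_bounded K x y : Theta K x y -> enorm (y - x) <= edist K x.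
Proof. by move=> [_ <-]; rewrite enormB. Qed.

Lemma compact_Theta K x : closed K -> compact (Theta K x).
Proof.
move=> clK; apply: (@enorm_bounded_compact _ _ _ x (edist K x)).
  exact: closed_Theta.
by move=> y; exact: Theta_bounded.
Qed.

Lemma encl_radius_le S c (r : R) : 0 <= r ->
  (forall y, S y -> enorm (y - c) <= r) -> encl_radius S <= r.
Proof.
move=> r0 h; apply: ge_inf; first by exists 0 => t [].
by split => //; exists c.
Qed.

End Distance.

(** * Smallest enclosing balls *)

Section Enclosing.
Set Implicit Arguments. Unset Strict Implicit.
Context {R : realType} {n : nat}.
Implicit Types (x y z c w : 'rV[R]_n) (K S : set 'rV[R]_n).

(** The ball around [x] makes the set of admissible radii nonempty; an empty one would have the
    default infimum 0. *)
Lemma le_encl_radius S x (q r : R) : S !=set0 ->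
  (forall y, S y -> enorm (y - x) <= r) ->
  (forall t c, 0 <= t -> (forall y, S y -> enorm (y - c) <= t) -> q <= t) ->
  q <= encl_radius S.
Proof.
move=> [y Sy] Sr h; apply: lb_le_inf => [|t [t0 [c Sc]]]; last exact: h Sc.
by exists r; split; [exact: le_trans (enorm_ge0 _) (Sr y Sy)|exists x].
Qed.

Lemma encl_radius_ge0 S x (r : R) : S !=set0 ->
  (forall y, S y -> enorm (y - x) <= r) -> 0 <= encl_radius S.
Proof. by move=> S0 Sr; apply: le_encl_radius Sr _. Qed.

(** The infimum is attained, so [get] finds a center: the farthest distance [f] to [S] is
    1-Lipschitz and has a minimum on the compact ball [D] around [y0], while outside [D] it exceeds
    [f y0]. *)
Lemma encl_centerP S x (r : R) : S !=set0 ->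
  (forall y, S y -> enorm (y - x) <= r) ->
  forall y, S y -> enorm (y - encl_center S) <= encl_radius S.
Proof.
move=> [y0 Sy0] Sr.
suff : exists c, forall y, S y -> enorm (y - c) <= encl_radius S.
  exact: (@getPex _ [set c | forall y, S y -> enorm (y - c) <= encl_radius S]).
pose f c := sup [set enorm (y - c) | y in S].
have f_ub c y : S y -> enorm (y - c) <= f c.
  move=> Sy; apply: ub_le_sup; last by exists y.
  exists (r + enorm (x - c)) => _ [z Sz <-].
  by rewrite (le_trans (enorm_triangle z x c)) // lerD2r Sr.
have f_lub c t : (forall y, S y -> enorm (y - c) <= t) -> f c <= t.
  move=> h; apply: sup_le_ub => [|_ [y Sy <-]]; last exact: h.
  by exists (enorm (y0 - c)), y0.
have f_cont : continuous f.
  apply: (@enorm_lipschitz_continuous _ _ _ 1) => c d; rewrite mul1r.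
  apply: f_lub => y Sy; rewrite (le_trans (enorm_triangle y d c)) //.
  by rewrite enormB (enormB c) lerD2r enormB f_ub.
pose D := [set c | enorm (c - y0) <= f y0].
have y0D : D y0.
  by rewrite /D /= subrr enorm0 (le_trans (enorm_ge0 (y0 - y0))) ?f_ub.
have cD : compact D.
  by apply: (@enorm_bounded_compact _ _ _ y0 (f y0)) => //; exact: closed_enorm_ball.
have [||c _ cmin] := EVT_min_rV (f := f) _ cD.
- by exists y0.
- exact: continuous_subspaceT.
exists c => y Sy; apply: le_trans (f_ub _ _ Sy) _.
apply: (le_encl_radius _ Sr) => [|t d t0 h]; first by exists y0.
apply: le_trans (f_lub _ _ h).
have [Dd|/ltW Dd] := leP (enorm (d - y0)) (f y0); first by apply: cmin; rewrite inE.
apply: le_trans (f_ub d y0 Sy0); rewrite enormB.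
by apply: le_trans Dd; apply: cmin; rewrite inE.
Qed.

Lemma encl_radius_homothety S x (r s : R) : 0 < s -> S !=set0 ->
  (forall y, S y -> enorm (y - x) <= r) ->
  encl_radius [set x + s *: (y - x) | y in S] = s * encl_radius S.
Proof.
move=> s0 S0 Sr.
have s0' : s^-1 * s = 1 by rewrite mulVf ?gt_eqF.
have r0 := encl_radius_ge0 S0 Sr.
apply/le_anti/andP; split.
  apply: (@encl_radius_le _ _ _ (x + s *: (encl_center S - x))).
    by rewrite mulr_ge0 // ltW.
  move=> _ [y Sy <-].
  have -> : x + s *: (y - x) - (x + s *: (encl_center S - x)) =
            s *: (y - encl_center S) by apply/rowP => i; rewrite !mxE; ring.
  by rewrite enormZ_ge0 ?(ltW s0) // ler_pM2l // (encl_centerP S0 Sr).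
apply: (@le_encl_radius _ x _ (s * r)).
- by have [y Sy] := S0; exists (x + s *: (y - x)), y.
- by move=> _ [y Sy <-]; rewrite addrC addKr enormZ_ge0 ?(ltW s0) // ler_pM2l // Sr.
- move=> t c t0 h; rewrite -ler_pdivlMl //.
  apply: (@encl_radius_le _ _ _ (x + s^-1 *: (c - x))).
    by rewrite mulr_ge0 // invr_ge0 ltW.
  move=> y Sy.
  have -> : y - (x + s^-1 *: (c - x)) = s^-1 *: (x + s *: (y - x) - c).
    apply/rowP => i; rewrite !mxE.
    (* The factor 1 is inserted so that [s0'] can turn it into [s^-1 * s]. *)
    have -> : y ord0 i - (x ord0 i + s^-1 * (c ord0 i - x ord0 i)) =
      1 * (y ord0 i - x ord0 i) - s^-1 * (c ord0 i - x ord0 i) by ring.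
    by rewrite -s0'; ring.
  by rewrite enormZ_ge0 ?invr_ge0 ?(ltW s0) // ler_pM2l ?invr_gt0 //; apply: h; exists y.
Qed.

End Enclosing.

(** * Superdifferential of the squared distance *)

Section Superdifferential.
Set Implicit Arguments. Unset Strict Implicit.
Context {R : realType} {n : nat}.
Variable K : set 'rV[R]_n.
Hypotheses (clK : closed K) (K0 : K !=set0).
Implicit Types (x y z c w : 'rV[R]_n).
Local Notation rho := (edist K).
Local Notation ctr x := (encl_center (Theta K x)).

(** Equivalently, [y - w] is a subgradient at [y] of the convex function
    [(|z|^2 - rho z ^+ 2) / 2]. *)
Definition supgrad y w := forall z,
  rho z ^+ 2 <= rho y ^+ 2 + 2 * dot w (z - y) + dot (z - y) (z - y).

Lemma Theta_encl x k : Theta K x k -> enorm (k - ctr x) <= Fk K x.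
Proof.
apply: (@encl_centerP _ _ _ x (rho x)); first exact: Theta_neq0.
by move=> y; exact: Theta_bounded.
Qed.

Lemma Fk_ge0 x : 0 <= Fk K x.
Proof.
apply: (@encl_radius_ge0 _ _ _ x (rho x)); first exact: Theta_neq0.
by move=> y; exact: Theta_bounded.
Qed.

Lemma Theta_encl_sqr x k : Theta K x k ->
  dot (k - ctr x) (k - ctr x) <= Fk K x ^+ 2.
Proof. by move=> /Theta_encl; rewrite enorm_leP // Fk_ge0. Qed.

Lemma Theta_sqr x k : Theta K x k -> dot (x - k) (x - k) = rho x ^+ 2.
Proof. by move=> [_ <-]; rewrite sqr_enorm. Qed.

Lemma Fk_sqr_le x c (q : R) :
  (forall k, Theta K x k -> dot (k - c) (k - c) <= q) -> Fk K x ^+ 2 <= q.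
Proof.
move=> h; have [k0 k0T] := Theta_neq0 x clK K0.
have q0 : 0 <= q by apply: le_trans (dot_ge0 _) (h _ k0T).
rewrite -[q]sqr_sqrtr // ler_pXn2r ?nnegrE ?Fk_ge0 ?sqrtr_ge0 //.
apply: (@encl_radius_le _ _ _ c); rewrite ?sqrtr_ge0 // => k kT.
by rewrite enorm_leP ?sqrtr_ge0 // sqr_sqrtr // h.
Qed.

(** Dual form of the fact that the center lies in the convex hull of [Theta K x]: were all nearest
    points strictly on one side, shifting the center toward them would shrink the ball. *)
Lemma encl_center_meets_halfspace x (u : 'rV[R]_n) :
  exists2 k, Theta K x k & 0 <= dot u (k - ctr x).
Proof.
have [||k /set_mem kT kmax] :=
    EVT_max_rV (f := fun k => dot u k) _ (compact_Theta (x := x) clK).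
- exact: Theta_neq0.
- by apply: continuous_subspaceT; exact: continuous_dot.
exists k => //; rewrite leNgt; apply/negP => neg.
set c := ctr x in neg *; set e := - dot u (k - c).
have e0 : 0 < e by rewrite oppr_gt0.
(* With [s * dot u u <= e], the gain [2 * s * e] exceeds the cost [s * s * dot u u] by at least
   [s * e]. *)
pose s := e / (dot u u + 1).
have s0 : 0 < s by rewrite divr_gt0 // ltr_wpDl ?dot_ge0.
have se : s * (dot u u + 1) = e.
  by rewrite divfK // gt_eqF // ltr_wpDl ?dot_ge0.
suff : Fk K x ^+ 2 <= Fk K x ^+ 2 - s * e by have := mulr_gt0 s0 e0; lra.
apply: (@Fk_sqr_le _ (c - s *: u)) => l lT.
have -> : dot (l - (c - s *: u)) (l - (c - s *: u)) =
  dot (l - c) (l - c) + 2 * s * dot u (l - c) + s * s * dot u u by dot_ring.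
have := Theta_encl_sqr lT; rewrite -/c.
have : dot u l <= dot u k by apply: kmax; rewrite inE.
have -> : dot u (l - c) = dot u l + - dot u k + dot u (k - c) by dot_ring.
have -> : dot u (k - c) = - e by rewrite opprK.
by move: se (dot_ge0 u) s0 e0; nra.
Qed.

(** A nearest point on the [u] side of the center gives the lower bound. For the upper one,
    comparing with the center [c + s *: u] and dividing by [s] gives the claim up to [s * dot u u],
    and [s] is chosen to make this at most [e]. *)
Lemma Fk_sqr x :
  Fk K x ^+ 2 = rho x ^+ 2 - dot (x - ctr x) (x - ctr x).
Proof.
set c := ctr x; set u := x - c; apply/le_anti/andP; split; last first.
  have [k kT ku] := encl_center_meets_halfspace x u.
  have := Theta_encl_sqr kT; rewrite -(Theta_sqr kT) -/c.
  have -> : dot (x - k) (x - k) =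
    dot (k - c) (k - c) - 2 * dot u (k - c) + dot u u by dot_ring.
  by lra.
apply/ler_addgt0Pr => e e0.
pose s := e / (dot u u + e).
have ue0 : 0 < dot u u + e by rewrite ltr_wpDl ?dot_ge0.
have s0 : 0 < s by rewrite divr_gt0.
have se : s * (dot u u + e) = e by rewrite divfK ?gt_eqF.
have s1 : s <= 1 by rewrite ler_pdivrMr // mul1r lerDr dot_ge0.
have : Fk K x ^+ 2 <= (1 - s) * Fk K x ^+ 2
    + s * (rho x ^+ 2 - dot u u) + s * s * dot u u.
  apply: (@Fk_sqr_le _ (c + s *: u)) => k kT.
  have := Theta_encl_sqr kT; rewrite -(Theta_sqr kT) -/c.
  have -> : dot (x - k) (x - k) =
    dot (k - c) (k - c) - 2 * dot u (k - c) + dot u u by dot_ring.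
  have -> : dot (k - (c + s *: u)) (k - (c + s *: u)) =
    dot (k - c) (k - c) - 2 * s * dot u (k - c) + s * s * dot u u by dot_ring.
  by nra.
have su : s * (s * dot u u) <= s * e.
  by rewrite ler_wpM2l ?(ltW s0) //; have := mulr_gt0 s0 e0; lra.
by move=> h; rewrite -(ler_pM2l s0); lra.
Qed.

(** A nearest point [k] with [0 <= dot (z - c) (k - c)] gives [rho z ^+ 2 <= |z - k|^2 <= |z - c|^2
    + Fk K x ^+ 2], and [Fk_sqr] concludes. *)
Lemma supgrad_center x : supgrad x (x - ctr x).
Proof.
move=> z; set c := ctr x.
have [k kT ku] := encl_center_meets_halfspace x (z - c).
have := Theta_encl_sqr kT; rewrite Fk_sqr -/c.
have := edist_sqr_le z kT.1; move: ku; rewrite -/c.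
have -> : dot (z - k) (z - k) = dot (z - c) (z - c)
  - 2 * dot (z - c) (k - c) + dot (k - c) (k - c) by dot_ring.
have -> : dot (z - c) (z - c) = dot (x - c) (x - c)
  + 2 * dot (x - c) (z - x) + dot (z - x) (z - x) by dot_ring.
by lra.
Qed.

(** Dual form of: [y - w] is in the convex hull of [Theta K y]. Points of [K] nearest to
    [y + s *: d] lie in the half-space defining [A], and their distance to [y] tends to [rho y] with
    [s]; so a point of [A] nearest to [y] is also nearest in [K]. *)
Lemma supgrad_meets_halfspace y w (d : 'rV[R]_n) : supgrad y w ->
  exists2 k, Theta K y k & 0 <= dot d (k - (y - w)).
Proof.
move=> yw; pose A := K `&` [set k | dot d (y - w) <= dot d k].
have near_A (s : R) : 0 < s ->
    exists2 k, A k & enorm (y - k) <= rho y + s * (2 * enorm d).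
  move=> s0; have [k kT] := Theta_neq0 (y + s *: d) clK K0.
  exists k.
    split; first exact: kT.1.
    have := yw (y + s *: d); rewrite -(Theta_sqr kT).
    have := edist_sqr_le y kT.1.
    have -> : dot (y + s *: d - k) (y + s *: d - k) =
      dot (y - k) (y - k) + 2 * s * dot d (y - k) + s * s * dot d d by dot_ring.
    have -> : dot w (y + s *: d - y) = s * dot d w by dot_ring.
    have -> : dot (y + s *: d - y) (y + s *: d - y) = s * s * dot d d by dot_ring.
    have -> : dot d (y - w) = dot d y - dot d w by dot_ring.
    have -> : dot d (y - k) = dot d y - dot d k by dot_ring.
    by rewrite /= => h1 h2; rewrite -(ler_pM2l s0); nra.
  have := edist_lipschitz (y + s *: d) y K0; rewrite -kT.2.
  have := enorm_triangle y (y + s *: d) k.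
  rewrite (enormB y (y + _)) (addrC y (s *: d)) addrK (enormZ_ge0 _ (ltW s0)) => h1 h2.
  by apply: le_trans h1 _; lra.
have A0 : A !=set0 by have [k Ak _] := near_A 1 ltr01; exists k.
have clA : closed A.
  apply: closedI => //.
  apply: (@preimage_closed _ _ (dot d) [set t | dot d (y - w) <= t]).
    by move=> z _; exact: continuous_dot.
  exact: closed_ge.
have [k [[Kk dk] yk]] := Theta_neq0 y clA A0.
exists k; last first.
  have -> : dot d (k - (y - w)) = dot d k - dot d (y - w) by dot_ring.
  by rewrite subr_ge0.
split => //; apply/le_anti; rewrite edist_le // andbT yk.
apply/ler_addgt0Pr => e e0.
have c0 : 0 < 2 * enorm d + 1 by have := enorm_ge0 d; lra.
have [l Al yl] := near_A (e / (2 * enorm d + 1)) (divr_gt0 e0 c0).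
apply: le_trans (edist_le y Al) _; apply: le_trans yl _; rewrite lerD2l.
by rewrite -mulrA ler_piMr ?(ltW e0) // ler_pdivrMl // mulr1 lerDl.
Qed.

(** With [Fk_sqr], this makes [y - ctr y] the shortest admissible [w]. The half-space is taken in
    the direction [y - c]. *)
Lemma Fk_sqr_ge y w : supgrad y w -> rho y ^+ 2 - dot w w <= Fk K y ^+ 2.
Proof.
move=> yw; set c := ctr y.
have [k kT] := supgrad_meets_halfspace (y - c) yw.
rewrite -(Theta_sqr kT); have := Theta_encl_sqr kT; rewrite -/c.
have -> : dot (k - c) (k - c) = dot (y - k) (y - k)
  + 2 * dot (y - c) (k - (y - w)) + dot (y - c - w) (y - c - w)
  + - dot w w by dot_ring.
by have := dot_ge0 (y - c - w); lra.
Qed.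

End Superdifferential.

(** * The implicit Euler step *)

Section EulerStep.
Set Implicit Arguments. Unset Strict Implicit.
Context {R : realType} {n : nat}.
Variable K : set 'rV[R]_n.
Hypotheses (clK : closed K) (K0 : K !=set0).
Implicit Types (x y z c w : 'rV[R]_n) (h : R).
Local Notation rho := (edist K).
Local Notation ctr x := (encl_center (Theta K x)).

(** At the point [y - w] the right-hand side of [supgrad] is [rho y ^+ 2 - dot w w]. *)
Lemma supgrad_enorm_le y w : supgrad K y w -> enorm w <= rho y.
Proof.
move=> /(_ (y - w)).
have -> : dot w (y - w - y) = - dot w w by dot_ring.
have -> : dot (y - w - y) (y - w - y) = dot w w by dot_ring.
by rewrite enorm_leP ?edist_ge0 //; have := sqr_ge0 (rho (y - w)); lra.
Qed.

Lemma supgrad_monotone y z v w : supgrad K y v -> supgrad K z w ->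
  dot (v - w) (y - z) <= dot (y - z) (y - z).
Proof.
move=> /(_ z) + /(_ y).
have -> : dot (z - y) (z - y) = dot (y - z) (y - z) by dot_ring.
have -> : dot (v - w) (y - z) = - dot v (z - y) - dot w (y - z) by dot_ring.
by lra.
Qed.

Lemma edist_step x w h : supgrad K (x + h *: w) w ->
  rho x ^+ 2 + h * (2 - h) * dot w w <= rho (x + h *: w) ^+ 2.
Proof.
move=> /(_ x).
have -> : dot w (x - (x + h *: w)) = - h * dot w w by dot_ring.
have -> : dot (x - (x + h *: w)) (x - (x + h *: w)) = h * h * dot w w by dot_ring.
by lra.
Qed.

Lemma edist_step_le x w h : 0 <= h -> h <= 1 -> supgrad K (x + h *: w) w ->
  rho x <= rho (x + h *: w).
Proof.
move=> h0 h1 /edist_step hx; rewrite -(@ler_pXn2r _ 2%N) ?nnegrE ?edist_ge0 //.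
apply: le_trans hx; rewrite lerDl mulr_ge0 ?dot_ge0 // mulr_ge0 //; lra.
Qed.

(** The inequalities at both ends of the step give [(1 - h) * dot w w <= dot v w], after division by
    [h], hence [(1 - h) ^+ 2 * dot w w <= dot v v]. The increase of [rho ^+ 2] covers the rest of
    [dot w w]. *)
Lemma Fk_step_le x w h : 0 <= h -> h <= 1 -> supgrad K (x + h *: w) w ->
  Fk K x <= Fk K (x + h *: w).
Proof.
move=> h0 h1 yw; have [->|hn0] := eqVneq h 0; first by rewrite scale0r addr0.
have hp : 0 < h by rewrite lt0r hn0.
rewrite -(@ler_pXn2r _ 2%N) ?nnegrE ?Fk_ge0 //.
apply: le_trans (Fk_sqr_ge clK K0 yw).
rewrite (Fk_sqr clK K0); have := edist_step yw.
have := supgrad_center clK K0 x (x + h *: w); set v := x - ctr x.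
have -> : dot v (x + h *: w - x) = h * dot v w by dot_ring.
have -> : dot (x + h *: w - x) (x + h *: w - x) = h * h * dot w w by dot_ring.
have := dot_ge0 (v - (1 - h) *: w).
have -> : dot (v - (1 - h) *: w) (v - (1 - h) *: w) =
  dot v v - 2 * (1 - h) * dot v w + (1 - h) * (1 - h) * dot w w by dot_ring.
move=> vw up dn.
have : h * ((1 - h) * dot w w) <= h * dot v w by lra.
rewrite ler_pM2l // => le_vw.
have h1' : 0 <= 1 - h by lra.
have := ler_wpM2l h1' le_vw; lra.
Qed.

(* Monotonicity of [y |-> y - w], the subgradients of the convex function
   [(|y|^2 - rho(y)^2) / 2], makes the implicit step Lipschitz. *)
Lemma step_lipschitz x y v w h k : 0 <= h <= 2^-1 ->
  supgrad K (x + h *: v) v -> supgrad K (y + k *: w) w ->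
  enorm (x + h *: v - (y + k *: w)) <=
    2 * (enorm (x - y) + `|h - k| * enorm w).
Proof.
move=> /andP[h0 h1] xv yw; have := supgrad_monotone xv yw.
set d := x + h *: v - _; set e := x - y + (h - k) *: w => mono.
have eq_d : h * dot (v - w) d = dot d d - dot e d by rewrite /d /e; dot_ring.
(* Since [h <= 2^-1], monotonicity costs at most half of [dot d d]; hence the constant 2. *)
have le_d : dot d d <= 2 * dot e d.
  by have := ler_wpM2l h0 mono; have := dot_ge0 d; nra.
have le_e : enorm e <= enorm (x - y) + `|h - k| * enorm w.
  by rewrite (le_trans (enormD _ _)) // enormZ.
have [->|d0] := eqVneq (enorm d) 0.
  by rewrite mulr_ge0 // addr_ge0 ?mulr_ge0 ?enorm_ge0.
have dp : 0 < enorm d by rewrite lt0r d0 enorm_ge0.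
have de : enorm d * enorm d <= 2 * enorm e * enorm d.
  by rewrite -expr2 sqr_enorm (le_trans le_d) // -mulrA ler_pM2l ?dot_le_enorm.
by rewrite ler_pM2r // in de; apply: le_trans de _; rewrite ler_pM2l.
Qed.

Variable M : R.
Hypothesis bK : forall z, M < enorm z -> K z.

Lemma edist_bounded : exists2 B, 0 <= B & forall x, rho x <= B.
Proof.
have [y0 Ky0] := K0; exists (`|M| + enorm y0) => [|x].
  by rewrite addr_ge0 ?enorm_ge0.
have [xM|/bK/edist_mem ->] := leP (enorm x) M; last first.
  by rewrite addr_ge0 ?enorm_ge0.
apply: le_trans (edist_le x Ky0) _; apply: le_trans (enormD _ _) _.
by rewrite -[- y0]sub0r enormB subr0 lerD2r (le_trans xM) ?ler_norm.
Qed.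

(** Subtracting [|z|^2] makes [rho z ^+ 2] an infimum of affine functions; the one of a point
    nearest to the intermediate point suffices. *)
Lemma sqr_edist_concave x y (s : R) : 0 <= s <= 1 ->
  (1 - s) * rho x ^+ 2 + s * rho y ^+ 2 - s * (1 - s) * dot (y - x) (y - x)
  <= rho (x + s *: (y - x)) ^+ 2.
Proof.
move=> /andP[s0 s1]; have [k kT] := Theta_neq0 (x + s *: (y - x)) clK K0.
rewrite -(Theta_sqr kT).
have -> : dot (x + s *: (y - x) - k) (x + s *: (y - x) - k) =
  (1 - s) * dot (x - k) (x - k) + s * dot (y - k) (y - k)
  - s * (1 - s) * dot (y - x) (y - x) by dot_ring.
have s1' : 0 <= 1 - s by lra.
rewrite lerD2r lerD //; apply: ler_wpM2l => //; apply: edist_sqr_le; exact: kT.1.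
Qed.

Lemma step_exists x h : 0 <= h < 1 -> exists w, supgrad K (x + h *: w) w.
Proof.
move=> /andP[h0 h1]; have [->|hn0] := eqVneq h 0.
  by exists (x - ctr x); rewrite scale0r addr0; exact: supgrad_center.
have hp : 0 < h by rewrite lt0r hn0.
have hV : h * h^-1 = 1 by rewrite mulfV.
have hV1 : 1 < h^-1 by rewrite invf_gt1.
pose G z := rho z ^+ 2 - h^-1 * dot (z - x) (z - x).
(* Outside [D], [rho] vanishes and [G z <= 0 <= G x], so a maximum on [D] is global. *)
pose D := [set z : 'rV[R]_n | enorm (z - 0) <= Num.max M (enorm x)].
have cD : compact D.
  apply: (@enorm_bounded_compact _ _ _ 0 (Num.max M (enorm x))) => //.
  exact: closed_enorm_ball.
have xD : D x by rewrite /D /= subr0 le_max lexx orbT.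
have [||y /set_mem yD ymaxD] := EVT_max_rV (f := G) _ cD.
- by exists x.
- have -> : G = (fun z => rho z * rho z - h^-1 * (enorm (z - x) * enorm (z - x))).
    by apply/funext => z; rewrite /G -sqr_enorm !expr2.
  apply: continuous_subspaceT => z.
  have crho : {for z, continuous rho} by exact: continuous_edist.
  have cdx : {for z, continuous (fun z => enorm (z - x))} by exact: continuous_enormB.
  exact: (continuousB (continuousM crho crho)
    (continuousM (@cst_continuous _ _ h^-1 z) (continuousM cdx cdx))).
have ymax z : G z <= G y.
  have [zD|zD] := boolP (z \in D); first exact: ymaxD.
  apply: (@le_trans _ _ (G x)); last by apply: ymaxD; rewrite inE.
  rewrite /G edist_mem; last first.
    apply: bK; move: zD; rewrite notin_setE /D /= subr0 => /negP.
    by rewrite -ltNge gt_max => /andP[].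
  have -> : dot (x - x) (x - x) = 0.
    by rewrite -sqr_enorm subrr enorm0 expr0n.
  by have := sqr_ge0 (rho x); have := dot_ge0 (z - x); nra.
(* [G] is strongly concave because [h < 1]. Comparing [G y] with [G] at [y + s *: (z - y)] for small
   [s] gives the quadratic term that [supgrad] requires. *)
have strict z : G z + (h^-1 - 1) * dot (z - y) (z - y) <= G y.
  set q := (h^-1 - 1) * _; have q0 : 0 <= q.
    by rewrite mulr_ge0 ?dot_ge0 // subr_ge0 ltW.
  apply/ler_addgt0Pr => e e0; pose s := e / (q + e).
  have qe : 0 < q + e by lra.
  have s0 : 0 < s by rewrite divr_gt0.
  have se : s * (q + e) = e by rewrite divfK ?gt_eqF.
  have s1 : s <= 1 by rewrite ler_pdivrMr //; lra.
  have /sqr_edist_concave : 0 <= s <= 1 by rewrite ltW.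
  move=> /(_ y z); have := ymax (y + s *: (z - y)); rewrite /G.
  have -> : dot (y + s *: (z - y) - x) (y + s *: (z - y) - x) =
    (1 - s) * dot (y - x) (y - x) + s * dot (z - x) (z - x)
    - s * (1 - s) * dot (z - y) (z - y) by dot_ring.
  move=> h2 h3; rewrite -(ler_pM2l s0).
  have : s * (s * q) <= s * e by rewrite ler_pM2l //; have := mulr_gt0 s0 e0; lra.
  by rewrite /q; lra.
exists (h^-1 *: (y - x)).
have -> : x + h *: (h^-1 *: (y - x)) = y by rewrite scalerA hV scale1r addrC subrK.
move=> z; have := strict z; rewrite /G.
have -> : dot (z - x) (z - x) = dot (z - y) (z - y) +
  2 * dot (y - x) (z - y) + dot (y - x) (y - x) by dot_ring.
have -> : dot (h^-1 *: (y - x)) (z - y) = h^-1 * dot (y - x) (z - y) by dot_ring.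
by lra.
Qed.

(** An arbitrary choice of direction, but [step_lipschitz] shows that [step] does not depend on it
    when [0 <= h <= 2^-1]. *)
Definition step_dir h x := get [set w | supgrad K (x + h *: w) w].
Definition step h x := x + h *: step_dir h x.

Lemma step_dirP h x : 0 <= h <= 2^-1 -> supgrad K (step h x) (step_dir h x).
Proof.
move=> /andP[h0 h1]; have /step_exists : 0 <= h < 1 by rewrite h0 /=; lra.
by move=> /(_ x); exact: (@getPex _ [set w | supgrad K (x + h *: w) w]).
Qed.

(** Directions are no longer than the bound [B] of [rho], so a step is Lipschitz in its size too;
    the constants compound by induction. *)
Lemma iter_step_lipschitz N : exists2 L : R, 0 <= L &
  forall h k x y, 0 <= h <= 2^-1 -> 0 <= k <= 2^-1 ->
  enorm (iter N (step h) x - iter N (step k) y)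
    <= L * (enorm (x - y) + `|h - k|).
Proof.
have [B B0 leB] := edist_bounded.
elim: N => [|N [L L0 IH]].
  by exists 1 => // h k x y _ _ /=; rewrite mul1r lerDl.
exists (2 * (L + B)) => [|h k x y hh kk /=]; first by rewrite mulr_ge0 ?addr_ge0.
set u := iter N _ x; set v := iter N _ y.
apply: le_trans (step_lipschitz hh (step_dirP u hh) (step_dirP v kk)) _.
rewrite -mulrA ler_pM2l // mulrDl lerD ?IH // mulrDr.
have : enorm (step_dir k v) <= B.
  by apply: le_trans (leB (step k v)); apply: supgrad_enorm_le; exact: step_dirP.
move=> /(ler_wpM2l (normr_ge0 (h - k))).
by rewrite mulrC (mulrC _ B) => /le_trans -> //; rewrite lerDr mulr_ge0 ?enorm_ge0.
Qed.

End EulerStep.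

(** * Offsets *)

Section Thicken.
Set Implicit Arguments. Unset Strict Implicit.
Context {R : realType} {n : nat}.
Variables (K : set 'rV[R]_n) (a : R).
Hypotheses (clK : closed K) (K0 : K !=set0) (a0 : 0 <= a).
Implicit Types (x y : 'rV[R]_n).
Local Notation rho := (edist K).

Lemma thicken_neq0 : thicken K a !=set0.
Proof. by have [y Ky] := K0; exists y; rewrite /thicken /= edist_mem. Qed.

Lemma edist_thicken_le x y : Theta K x y -> a < rho x ->
  thicken K a (x + ((rho x - a) / rho x) *: (y - x)).
Proof.
move=> [Ky xy] ax; have r0 : 0 < rho x by exact: le_lt_trans ax.
apply: le_trans (edist_le _ Ky) _.
have -> : x + ((rho x - a) / rho x) *: (y - x) - y = (a / rho x) *: (x - y).
  by apply/rowP => i; rewrite !mxE; field; rewrite gt_eqF.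
by rewrite enormZ_ge0 ?divr_ge0 ?(ltW r0) // xy divfK ?gt_eqF.
Qed.

Lemma edist_thicken x : a < rho x -> edist (thicken K a) x = rho x - a.
Proof.
move=> ax; have r0 : 0 < rho x by exact: le_lt_trans ax.
apply/le_anti/andP; split.
  have [y yT] := Theta_neq0 x clK K0.
  apply: le_trans (edist_le x (edist_thicken_le yT ax)) _.
  rewrite enormB addrC addKr enormZ_ge0 ?divr_ge0 ?subr_ge0 ?(ltW r0) ?(ltW ax) //.
  by rewrite enormB yT.2 divfK ?gt_eqF.
apply: le_edist => [|y]; first exact: thicken_neq0.
rewrite /thicken /= => ya; have := edist_lipschitz x y K0; lra.
Qed.

(** If [y] is nearest to [x] in the offset and [k] nearest to [y] in [K], the triangle inequality
    for [x], [y], [k] is an equality. This puts [y] on the segment: its squared distance to the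
    expected point expands to 0. *)
Lemma Theta_thicken x : a < rho x -> Theta (thicken K a) x =
  [set x + ((rho x - a) / rho x) *: (y - x) | y in Theta K x].
Proof.
move=> ax; have r0 : 0 < rho x by exact: le_lt_trans ax.
have s0 : 0 <= (rho x - a) / rho x.
  by rewrite divr_ge0 ?(ltW r0) // subr_ge0 ltW.
rewrite /Theta edist_thicken //; apply/seteqP; split=> [y [ya xy]|y [k kT <-]]; last first.
  split; first exact: edist_thicken_le.
  by rewrite enormB addrC addKr enormZ_ge0 // enormB kT.2 divfK ?gt_eqF.
rewrite /thicken /= in ya; have [k [Kk yk]] := Theta_neq0 y clK K0.
have xk : enorm (x - k) = rho x.
  apply/le_anti; rewrite edist_le // andbT.
  by apply: le_trans (enorm_triangle x y k) _; rewrite xy yk; lra.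
have yka : enorm (y - k) = a.
  apply/le_anti; rewrite {1}yk ya /=.
  by have := enorm_triangle x y k; rewrite xy xk; lra.
exists k => //; apply/esym/eqP; rewrite -subr_eq0; apply/eqP/enorm_eq0/eqP.
rewrite -sqrf_eq0 sqr_enorm; apply/eqP.
set s := _ / rho x in s0 *.
have sr : s * rho x = rho x - a by rewrite divfK ?gt_eqF.
have eq_yk : dot (y - k) (y - k) =
  dot (x - y) (x - y) - 2 * dot (x - y) (x - k) + dot (x - k) (x - k) by dot_ring.
have -> : dot (y - (x + s *: (k - x))) (y - (x + s *: (k - x))) =
  dot (x - y) (x - y) - 2 * s * dot (x - y) (x - k) + s * s * dot (x - k) (x - k)
  by dot_ring.
move: eq_yk; rewrite -!sqr_enorm xy xk yka => eq_yk.
have -> : dot (x - y) (x - k) = rho x * (rho x - a) by lra.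
have -> : (rho x - a) ^+ 2 - 2 * s * (rho x * (rho x - a)) + s * s * rho x ^+ 2 =
  (rho x - a) ^+ 2 - 2 * (s * rho x) * (rho x - a) + (s * rho x) ^+ 2 by ring.
by rewrite sr; ring.
Qed.

Lemma Fk_thicken x : a < rho x ->
  Fk (thicken K a) x = (rho x - a) / rho x * Fk K x.
Proof.
move=> ax; have r0 : 0 < rho x by exact: le_lt_trans ax.
rewrite /Fk Theta_thicken //.
apply: (@encl_radius_homothety _ _ _ _ (rho x)); last by move=> y; exact: Theta_bounded.
  by rewrite divr_gt0 // subr_gt0.
exact: Theta_neq0.
Qed.

Lemma Fk_thicken_le0 x : rho x <= a -> Fk (thicken K a) x <= 0.
Proof.
move=> xa; apply: (@encl_radius_le _ _ _ x) => // y [_].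
by rewrite (edist_mem (K := thicken K a)) // enormB => ->.
Qed.

End Thicken.

(** * Continuity on a subset from Euclidean estimates *)

Section Continuity.
Set Implicit Arguments. Unset Strict Implicit.
Context {R : realType} {n : nat}.

(** The estimate is asked on [A] only, as the homotopy is controlled only for times in [[0, 1]]. *)
Lemma within_continuous_le (T : topologicalType) (A : set T)
    (H : T -> 'rV[R]_n) (g : T -> T -> R) :
  (forall p q, A p -> A q -> enorm (H p - H q) <= g p q) ->
  (forall p, g p q @[q --> p] --> (0 : R)) ->
  {within A, continuous H}.
Proof.
move=> Hg g0; apply/subspace_continuousP => p Ap.
apply/(@cvgrPdist_le _ _ _ (within A (nbhs p))) => e e0.
rewrite near_withinE; near=> q => Aq.
apply: le_trans (norm_le_enorm _) _; apply: le_trans (Hg p q Ap Aq) _.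
suff : `|0 - g p q| <= e by rewrite sub0r normrN; apply: le_trans; exact: ler_norm.
by near: q; have /cvgrPdist_le := g0 p; apply.
Unshelve. all: by end_near. Qed.

Lemma cvg_enormB (x : 'rV[R]_n) : enorm (x - y) @[y --> x] --> (0 : R).
Proof.
rewrite -(@enorm0 R n) -(subrr x).
under eq_fun do rewrite enormB.
exact: continuous_enormB.
Qed.

End Continuity.

(** * The homotopy equivalence *)

Section CriticalFunction.
Set Implicit Arguments. Unset Strict Implicit.
Context {R : realType} {n : nat}.
Implicit Types (K : set 'rV[R]_n) (x : 'rV[R]_n).

Lemma chi_le K x : chi K (edist K x) <= enorm (gradK K x).
Proof.
rewrite /chi; case: pselect => [ex_x|[]]; last by exists x.
by apply: ge_inf; [exists 0 => _ [y _ <-]; exact: enorm_ge0|exists x].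
Qed.

Lemma lt_r_mu_chi K (mu a t : R) : a < t -> (t%:E < r_mu mu a K)%E ->
  mu <= chi K t.
Proof.
move=> at_ tr; rewrite leNgt; apply/negP => chit.
move: tr; rewrite ltNge => /negP; apply; apply: ereal_inf_lbound.
by exists t.
Qed.

(** A real [b] also covers an infinite [r_mu]. The gap [s < b] later makes the constant [D2]
    positive. *)
Lemma r_mu_witness K (mu a s : R) : (s%:E < r_mu mu a K)%E ->
  exists2 b, s < b & forall t, a < t -> t < b -> mu <= chi K t.
Proof.
move=> sr; suff [b sb br] : exists2 b, s < b & (b%:E <= r_mu mu a K)%E.
  exists b => // t at_ tb; apply: (lt_r_mu_chi at_).
  by apply: lt_le_trans br; rewrite lte_fin.
case E : (r_mu mu a K) sr => [r| |] // sr.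
  by exists r => //; rewrite lte_fin in sr.
by exists (s + 1); rewrite ?leey // ltrDl.
Qed.

Lemma bounded_compl_enorm K : bounded_set (~` K) ->
  exists M, forall z, M < enorm z -> K z.
Proof.
move=> [M [_ hM]]; exists (Num.sqrt n%:R * (M + 1)) => z Mz.
apply: contrapT => Kz; move: Mz; rewrite ltNge => /negP; apply.
apply: le_trans (enorm_le_norm z) _.
by rewrite ler_wpM2l ?sqrtr_ge0 // (hM (M + 1)) // ltrDl.
Qed.

(** In positive dimension some vector exceeds the bound; in dimension zero [K] may be empty. *)
Lemma bounded_compl_neq0 K : (0 < n)%N -> bounded_set (~` K) -> K !=set0.
Proof.
move=> n0 /bounded_compl_enorm[M hM].
exists (const_mx (`|M| + 1)); apply: hM; apply: lt_le_trans (norm_le_enorm _).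
apply: (@lt_le_trans _ _ (`|M| + 1)); first by have := ler_norm M; lra.
have := norm_coord_le (const_mx (`|M| + 1) : 'rV[R]_n) (Ordinal n0).
by rewrite mxE ger0_norm // addr_ge0.
Qed.

End CriticalFunction.

(** * Deformation of the offset complement into the medial axis *)

Section Retraction.
Set Implicit Arguments. Unset Strict Implicit.
Context {R : realType} {n : nat}.
Variables (K : set 'rV[R]_n) (alpha lambda mu alpha' M b : R).
Hypotheses (clK : closed K) (K0 : K !=set0).
Hypothesis bK : forall z, M < enorm z -> K z.
Hypotheses (lambda0 : 0 < lambda) (mu0 : 0 < mu).
Hypotheses (alpha'0 : 0 < alpha') (alpha'_le : alpha' <= alpha).
Hypotheses (b_gt : alpha + lambda < b)
  (chi_ge : forall t, alpha' < t -> t < b -> mu <= chi K t).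
Implicit Types (x y w : 'rV[R]_n) (h : R).
Local Notation rho := (edist K).
Local Notation A := (ax lambda alpha K).

Let alpha0 : 0 <= alpha. Proof. exact: le_trans (ltW alpha'0) alpha'_le. Qed.

Lemma ax_edist_gt x : A x -> alpha < rho x.
Proof.
rewrite /ax /= ltNge => h; apply/negP => /Fk_thicken_le0 /(le_trans h).
by rewrite leNgt lambda0.
Qed.

Lemma ax_mono x y : rho x <= rho y -> Fk K x <= Fk K y -> A x -> A y.
Proof.
move=> rxy Fxy Ax; have xa := ax_edist_gt Ax; move: Ax.
have ay : alpha < rho y by lra.
have rx0 := le_lt_trans alpha0 xa.
have ry0 := le_lt_trans alpha0 ay.
rewrite /ax /= !Fk_thicken // => /le_trans; apply.
apply: ler_pM => //; rewrite ?Fk_ge0 //.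
  by rewrite divr_ge0 ?(ltW rx0) // subr_ge0 ltW.
rewrite ler_pdivrMr // mulrAC ler_pdivlMr //.
by have := ler_wpM2l alpha0 rxy; lra.
Qed.

Lemma ax_step x h : 0 <= h <= 2^-1 -> A x -> A (step K h x).
Proof.
move=> hh; have yw := step_dirP clK K0 bK x hh; case/andP: hh => h0 h1.
by apply: ax_mono; [apply: edist_step_le|apply: Fk_step_le] => //; lra.
Qed.

Lemma edist_gt_step x h : 0 <= h <= 2^-1 -> alpha' < rho x ->
  alpha' < rho (step K h x).
Proof.
move=> hh; have yw := step_dirP clK K0 bK x hh; case/andP: hh => h0 h1 ax.
by apply: lt_le_trans ax _; apply: edist_step_le => //; lra.
Qed.

Lemma ax_iter N x h : 0 <= h <= 2^-1 -> A x -> A (iter N (step K h) x).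
Proof. by move=> hh Ax; elim: N => //= N; exact: ax_step. Qed.

Lemma edist_gt_iter N x h : 0 <= h <= 2^-1 -> alpha' < rho x ->
  alpha' < rho (iter N (step K h) x).
Proof. by move=> hh Ax; elim: N => //= N; exact: edist_gt_step. Qed.

Lemma supgrad_bounded_below : exists2 delta, 0 < delta &
  forall x w, alpha' < rho x -> ~ A x -> supgrad K x w -> delta <= dot w w.
Proof.
(* The bound for [b <= rho x]: off the medial axis [(b - alpha) * Fk K x <= lambda * rho x], and
   [rho x ^+ 2 - dot w w <= Fk K x ^+ 2]. *)
pose D2 := ((b - alpha) ^+ 2 - lambda ^+ 2) * b ^+ 2 / (b - alpha) ^+ 2.
have ab := b_gt; have l0 := lambda0; have a0 := alpha0.
have ba : 0 < b - alpha by lra.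
exists (Num.min ((alpha' * mu) ^+ 2) D2) => [|x w ax nAx xw].
  rewrite lt_min; apply/andP; split; first by rewrite exprn_gt0 // mulr_gt0.
  rewrite divr_gt0 ?exprn_gt0 // mulr_gt0 ?exprn_gt0 //; last by lra.
  by rewrite subr_gt0 ltr_pXn2r ?nnegrE //; lra.
have r0 := lt_trans alpha'0 ax.
have := Fk_sqr_ge clK K0 xw.
rewrite ge_min; have [xb|xb] := ltP (rho x) b.
  (* By [hw] the center direction is no longer than [w]; [chi_ge] bounds its length below by
     [mu * rho x]. *)
  rewrite Fk_sqr // => hw; apply/orP; left.
  suff : (alpha' * mu) ^+ 2 <=
    dot (x - encl_center (Theta K x)) (x - encl_center (Theta K x)) by lra.
  rewrite -sqr_enorm ler_pXn2r ?nnegrE ?enorm_ge0 ?mulr_ge0 ?(ltW alpha'0) ?(ltW mu0) //.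
  have := le_trans (chi_ge ax xb) (chi_le K x).
  rewrite /gradK enormZ_ge0 ?invr_ge0 ?(ltW r0) // mulrC ler_pdivlMr // => h.
  by apply: le_trans h; rewrite mulrC ler_pM2l // ltW.
move=> hw; apply/orP; right.
have aR : alpha < rho x by lra.
have : Fk (thicken K alpha) x < lambda by rewrite ltNge; apply/negP.
rewrite Fk_thicken // mulrAC ltr_pdivrMr // => hF.
have F0 := Fk_ge0 clK K0 x.
have hF' : (b - alpha) * Fk K x <= lambda * rho x.
  by apply: le_trans (ltW hF); rewrite ler_wpM2r // lerD2r.
have : ((b - alpha) * Fk K x) ^+ 2 <= (lambda * rho x) ^+ 2.
  by rewrite ler_pXn2r ?nnegrE ?mulr_ge0 // ltW.
rewrite !exprMn => hF2.
have b2 : 0 < (b - alpha) ^+ 2 by rewrite exprn_gt0.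
rewrite /D2 ler_pdivrMr //.
have rb : b ^+ 2 <= rho x ^+ 2 by rewrite ler_pXn2r ?nnegrE //; lra.
have l2 : 0 <= (b - alpha) ^+ 2 - lambda ^+ 2.
  by rewrite subr_ge0 ler_pXn2r ?nnegrE //; lra.
have h1 := ler_wpM2l l2 rb.
have h2 := ler_wpM2l (ltW b2) hw.
lra.
Qed.

Lemma iter_step_into_ax : exists N, forall x, alpha' < rho x ->
  A (iter N (step K 2^-1) x).
Proof.
have [delta d0 hd] := supgrad_bounded_below.
have [B B0 leB] := edist_bounded K0 bK.
have hh : 0 <= (2^-1 : R) <= 2^-1 by rewrite lexx andbT invr_ge0.
(* The factor [3 / 4] is [h * (2 - h)] at [h = 2^-1]. By [ax_step], an iterate off the medial axis
   has all its predecessors off it. *)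
have grow N x : alpha' < rho x -> ~ A (iter N (step K 2^-1) x) ->
    N%:R * (3 / 4 * delta) <= rho (iter N (step K 2^-1) x) ^+ 2.
  move=> ax; elim: N => [|N IH] /= nA; first by rewrite mul0r sqr_ge0.
  set u := iter N _ x in IH nA *.
  have {}IH := IH (fun Au => nA (ax_step hh Au)).
  have yw := step_dirP clK K0 bK u hh.
  have := hd _ _ (edist_gt_step hh (edist_gt_iter N hh ax)) nA yw.
  have := edist_step yw; rewrite -/(step K 2^-1 u).
  by rewrite -[N.+1%:R]natr1; lra.
pose q := B ^+ 2 / (3 / 4 * delta).
have d0' : 0 < 3 / 4 * delta by rewrite mulr_gt0.
have q0 : 0 <= q by rewrite divr_ge0 ?sqr_ge0 // ltW.
exists (Num.bound q) => x ax; apply: contrapT => /(grow _ _ ax).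
apply/negP; rewrite -ltNge.
have := archi_boundP q0; rewrite ltr_pdivrMr //; apply: le_lt_trans.
by rewrite ler_pXn2r ?nnegrE ?edist_ge0.
Qed.

Lemma step0 x : step K 0 x = x.
Proof. by rewrite /step scale0r addr0. Qed.

(** The step size falls from [2^-1] at time 0, where the composite map is due, to 0 at time 1, where
    [step] is the identity. *)
Lemma homotopy_half (t : R) : `[0, 1]%classic t -> 0 <= (1 - t) / 2 <= 2^-1.
Proof.
rewrite /= in_itv /= => /andP[t0 t1]; rewrite divr_ge0 ?subr_ge0 //=.
by rewrite ler_pdivrMr // mulVf //; lra.
Qed.

Lemma continuous_homotopy N (B : set 'rV[R]_n) :
  {within B `*` `[0, 1]%classic,
    continuous (fun p : 'rV[R]_n * R => iter N (step K ((1 - p.2) / 2)) p.1)}.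
Proof.
have [L L0 hL] := iter_step_lipschitz clK K0 bK N.
apply: (@within_continuous_le _ _ _ _ _ (fun p q : 'rV[R]_n * R =>
   L * (enorm (p.1 - q.1) + `|(1 - p.2) / 2 - (1 - q.2) / 2|))).
  by move=> p q [_ /homotopy_half hp] [_ /homotopy_half hq]; exact: hL.
move=> p.
have c1 : enorm (p.1 - q.1) @[q --> p] --> (0 : R).
  apply: (cvg_comp (fun q : 'rV[R]_n * R => q.1) (fun y => enorm (p.1 - y)) _
    (cvg_enormB p.1)).
  by case: (p) => p1 p2; exact: cvg_fst.
have c2 : `|(1 - p.2) / 2 - (1 - q.2) / 2| @[q --> p] --> (0 : R).
  rewrite -(@normr0 _ R) -(subrr ((1 - p.2) / 2)); apply: cvg_norm.
  apply: cvgB; first exact: cvg_cst.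
  apply: cvgM; last exact: cvg_cst.
  apply: cvgB; first exact: cvg_cst.
  by case: (p) => p1 p2; exact: cvg_snd.
by rewrite -(mulr0 L) -[X in L * X](addr0 0); apply: cvgM; [exact: cvg_cst|exact: cvgD].
Qed.

Lemma continuous_iter_step N h (B : set 'rV[R]_n) : 0 <= h <= 2^-1 ->
  {within B, continuous (iter N (step K h))}.
Proof.
move=> hh; have [L L0 hL] := iter_step_lipschitz clK K0 bK N.
apply: (@within_continuous_le _ _ 'rV[R]_n _ _ (fun p q => L * enorm (p - q))).
  by move=> p q _ _; apply: le_trans (hL _ _ p q hh hh) _; rewrite subrr normr0 addr0.
by move=> p; rewrite -(mulr0 L); exact: (cvgM (cvg_cst L) (cvg_enormB p)).
Qed.

Lemma iter_step0 N x : iter N (step K 0) x = x.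
Proof. by elim: N => //= N ->; exact: step0. Qed.

(** The maps are the inclusion and the [N]-fold half step. Both composites are that iterate, so one
    formula gives both homotopies. *)
Lemma ax_homotopy_equiv : homotopy_equiv A (~` thicken K alpha').
Proof.
have [N hN] := iter_step_into_ax.
have notin_thicken y : (~` thicken K alpha') y <-> alpha' < rho y.
  by rewrite /thicken /= ltNge; split => [/negP|/negP].
have hh : 0 <= (2^-1 : R) <= 2^-1 by rewrite lexx andbT invr_ge0.
exists id, (iter N (step K 2^-1)); split.
- split; first by apply: continuous_subspaceT => x; exact: cvg_id.
  by move=> x /ax_edist_gt ax; apply/notin_thicken; exact: le_lt_trans ax.
- split; first exact: continuous_iter_step.
  by move=> y /notin_thicken; exact: hN.
- exists (fun p : 'rV[R]_n * R => iter N (step K ((1 - p.2) / 2)) p.1); split.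
  + exact: continuous_homotopy.
  + by move=> x t Ax /homotopy_half ht; exact: ax_iter.
  + by move=> x _ /=; rewrite subr0 div1r.
  + by move=> x _ /=; rewrite subrr mul0r iter_step0.
- exists (fun p : 'rV[R]_n * R => iter N (step K ((1 - p.2) / 2)) p.1); split.
  + exact: continuous_homotopy.
  + move=> x t /notin_thicken ax /homotopy_half ht; apply/notin_thicken.
    exact: edist_gt_iter.
  + by move=> x _ /=; rewrite subr0 div1r.
  + by move=> x _ /=; rewrite subrr mul0r iter_step0.
Qed.

End Retraction.

Theorem theorem9p7 (R : realType) (n : nat) (K : set 'rV[R]_n)
    (alpha lambda mu alpha' : R) :
  (0 < n)%N ->
  closed K -> bounded_set (~` K) ->
  0 <= alpha -> 0 < lambda -> 0 < mu -> mu <= 1 ->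
  0 < alpha' -> alpha' <= alpha ->
  ((alpha + lambda)%:E < r_mu mu alpha' K)%E ->
  homotopy_equiv (ax lambda alpha K) (~` thicken K alpha').
Proof.
move=> n0 clK bK _ lambda0 mu0 _ alpha'0 alpha'_le /r_mu_witness[b b_gt chi_ge].
have K0 := bounded_compl_neq0 n0 bK.
have [M hM] := bounded_compl_enorm bK.
exact: (ax_homotopy_equiv clK K0 hM lambda0 mu0 alpha'0 alpha'_le b_gt chi_ge).
Qed.
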